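(* Let $\epsilon>0$. Let $f:\mathbb{F}_2^n\to\{0,1\}$ have expectation $a=\mathbb{E}f$ and let $k=\dim(\mathrm{Span}(\mathrm{Spec}_\epsilon(f)))$, with $k\ge1$. Let $h:\{\pm1\}^n\to[0,1]$ be $$h(\mathbf x)=\mathbf 1\left\{\sum_{i=1}^kx_i>b\right\}+\lambda\cdot\mathbf 1\left\{\sum_{i=1}^kx_i=b\right\}$$ for some $b\in\mathbb{N}=\{0,1,2,\dots\}$ and $\lambda\in(0,1]$ such that $\mathbb{E}h=a$. Suppose that there is a set $C\subseteq\{\pm1\}^n$ with $\mu(C)=a$ and $$\left\{\mathbf x:\sum_{i=1}^kx_i>b\right\}\subseteq C\subseteq\left\{\mathbf x:\sum_{i=1}^kx_i\ge b\right\}$$ such that, with $g=\mathbf 1_C$, the coefficients $\hat g_i$, $i\in\{1,\dots,k\}$, are all equal. Then $\hat g_1=\hat h_1$ and $\epsilon\le a^{-1}\hat g_1$. In particular, when $a=2^{-k}\binom{k}{\le r}$ for some integer $0\le r\le k$, the set $C$ can be chosen as the Hamming ball $\{\mathbf x\in\{\pm1\}^n:\sum_{i=1}^kx_i\ge k-2r\}$, and in this case $$\epsilon\le\frac{\binom{k-1}{r}}{\binom{k}{\le r}},\qquad\text{where }\binom{k}{\le r}=\sum_{j=0}^r\binom kj .$$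
   Context: Expectations are with respect to the uniform measure on $\mathbb{F}_2^n$ or on $\{\pm1\}^n$; $\mu$ is the uniform probability measure on $\{\pm1\}^n$. For $f:\mathbb{F}_2^n\to\{0,1\}$ and $\mathbf y\in\mathbb{F}_2^n$, $\hat f(\mathbf y)=2^{-n}\sum_{\mathbf x\in\mathbb{F}_2^n}f(\mathbf x)(-1)^{\langle\mathbf x,\mathbf y\rangle}$, and $\|f\|_1=\mathbb{E}|f|=\mathbb{E}f$. The $\epsilon$-spectrum of $f$ is $$\mathrm{Spec}_\epsilon(f)=\{\mathbf y\in\mathbb{F}_2^n:|\hat f(\mathbf y)|>\epsilon\|f\|_1\},$$ and $\mathrm{Span}$, $\dim$ are taken over $\mathbb{F}_2$. For $g:\{\pm1\}^n\to\mathbb{R}$, $\hat g_i=\mathbb{E}[g(\mathbf X)X_i]$ with $\mathbf X$ uniform on $\{\pm1\}^n$. *)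

(* Defs.v *)
From mathcomp Require Import all_boot all_order all_algebra.
From mathcomp Require Import reals.

Set Implicit Arguments.
Unset Strict Implicit.
Unset Printing Implicit Defensive.

Import Order.TTheory GRing.Theory Num.Theory.

Local Open Scope ring_scope.

Definition expectation (R : realType) (T : finType) (g : T -> R) : R :=
  (\sum_x g x) / #|T|%:R.

Definition inner (n : nat) (x y : 'rV['F_2]_n) : 'F_2 :=
  \sum_(i < n) x ord0 i * y ord0 i.

Definition fourier (R : realType) (n : nat) (f : 'rV['F_2]_n -> R)
    (y : 'rV['F_2]_n) : R :=
  2 ^- n * \sum_(x : 'rV['F_2]_n) f x * (-1) ^+ nat_of_ord (inner x y).

Definition norm1 (R : realType) (n : nat) (f : 'rV['F_2]_n -> R) : R :=
  expectation (fun x => `|f x|).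

Definition Spec (R : realType) (n : nat) (eps : R) (f : 'rV['F_2]_n -> R) :
    {set 'rV['F_2]_n} :=
  [set y | eps * norm1 f < `|fourier f y|].

Definition dim_span_Spec (R : realType) (n : nat) (eps : R)
    (f : 'rV['F_2]_n -> R) : nat :=
  \dim <<enum (Spec eps f)>>%VS.

(* The two-element set {1, -1} of integers, as a finite type; [ssval] is the
   inclusion into [int]. *)
Definition pm1 : finType := seq_sub [:: 1 : int; -1].

Definition cube (n : nat) : finType := {ffun 'I_n -> pm1}.

Definition coord (n : nat) (x : cube n) (i : 'I_n) : int := ssval (x i).

(* Coordinates are numbered from 0, so the first k of them are the i < k. *)
Definition psum (n k : nat) (x : cube n) : int :=
  \sum_(i < n | (i < k)%N) coord x i.

Definition mu (R : realType) (n : nat) (C : {set cube n}) : R :=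
  #|C|%:R / #|cube n|%:R.

Definition indic (R : realType) (n : nat) (C : {set cube n}) : cube n -> R :=
  fun x => (x \in C)%:R.

Definition level1_coef (R : realType) (n : nat) (g : cube n -> R)
    (i : 'I_n) : R :=
  expectation (fun x : cube n => g x * (coord x i)%:~R).

Definition threshold (R : realType) (n k b : nat) (lambda : R) :
    cube n -> R :=
  fun x => (b%:Z < psum k x)%R%:R + lambda * (psum k x == b%:Z)%:R.

Definition coefs_equal (R : realType) (n k : nat) (g : cube n -> R) : Prop :=
  forall i j : 'I_n, (i < k)%N -> (j < k)%N ->
    level1_coef g i = level1_coef g j.

Definition sandwiched (n k b : nat) (C : {set cube n}) : bool :=
  ([set x | b%:Z < psum k x] \subset C)
    && (C \subset [set x | b%:Z <= psum k x]).

Definition hamming_ball (n k r : nat) : {set cube n} :=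
  [set x | k%:Z - 2 * r%:Z <= psum k x].

Definition bin_le (k r : nat) : nat := (\sum_(0 <= j < r.+1) 'C(k, j))%N.

(* Main.v *)
(* Choose k linearly independent y_1, ..., y_k in the spectrum and extend them to
   a basis of F_2^n.  Up to signs s_i, the characters of this basis give a
   bijection F_2^n -> {1,-1}^n carrying s_1 (-1)^<x,y_1> + ... + s_k (-1)^<x,y_k>
   to S(x) = x_1 + ... + x_k; with suitable signs the transported f has
   E(f S) = sum_i |fourier f y_i| >= k eps a.  Among [0,1]-valued functions of mean
   a, E(f S) is maximal at a threshold of S (Neyman-Pearson), such as 1_C, h or the
   Hamming ball, for which E(g S) = k g^_1 when the first k coefficients agree. *)
Require Import Defs.
From mathcomp Require Import all_boot all_order all_algebra perm.
From mathcomp Require Import reals zify.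

Set Implicit Arguments.
Unset Strict Implicit.
Unset Printing Implicit Defensive.

Import Order.TTheory GRing.Theory Num.Theory.

Local Open Scope ring_scope.

(** * Extremality of threshold functions (Neyman-Pearson) *)

(** Each product [(G x - F x) * (S x - t)] is nonnegative, and equal totals cancel the terms in [t].
    The value of [G] where [S x = t] is left free, so the lemma covers both sets and randomized
    thresholds. *)
Lemma sum_threshold_le (R : realType) (T : finType) (S F G : T -> R) (t : R) :
  (forall x, 0 <= F x <= 1) ->
  (forall x, t < S x -> G x = 1) -> (forall x, S x < t -> G x = 0) ->
  \sum_x F x = \sum_x G x -> \sum_x F x * S x <= \sum_x G x * S x.
Proof.
move=> F01 G1 G0 eqFG; rewrite -subr_ge0 -sumrB.
suff -> : \sum_x (G x * S x - F x * S x) = \sum_x (G x - F x) * (S x - t).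
  apply: sumr_ge0 => x _; have /andP[F0 F1] := F01 x.
  case: (ltrgtP t (S x)) => [tS|St|->]; last by rewrite subrr mulr0.
    by rewrite G1 // mulr_ge0 // subr_ge0 // ltW.
  by rewrite G0 // sub0r mulr_le0 ?oppr_le0 // subr_le0 ltW.
under [RHS]eq_bigr => x _ do rewrite mulrBr mulrBl.
by rewrite [RHS]sumrB -mulr_suml [in X in _ - X * t]sumrB eqFG subrr mul0r subr0.
Qed.

(** * Bases through a spanning set, and coordinates over F_2 *)

Lemma span_free_subset (K : fieldType) (V : vectType K) (X : seq V) :
  exists Y, [/\ {subset Y <= X}, free Y & <<Y>>%VS = <<X>>%VS].
Proof.
elim: X => [|v X [Y [YX fY eqY]]]; first by exists [::]; rewrite nil_free.
have [vY|vNY] := boolP (v \in <<Y>>%VS).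
  exists Y; split=> // [y /YX yX|]; first by rewrite inE yX orbT.
  by rewrite span_cons -eqY; apply/esym/addv_idPr; rewrite -memvE.
exists (v :: Y); split.
- by move=> y; rewrite !inE => /orP[->//|/YX->]; rewrite orbT.
- by rewrite free_cons vNY.
- by rewrite !span_cons eqY.
Qed.

(** A free subfamily of [X] with the same span comes first, followed by a basis of a complement.
    With [X] the spectrum, the first k basis vectors thus have large Fourier coefficients. *)
Lemma span_basis_prefix (K : fieldType) (V : vectType K) (X : seq V) :
  exists B : seq V, [/\ basis_of fullv B, size B = dim V,
    (\dim <<X>> <= dim V)%N
    & forall i, (i < \dim <<X>>)%N -> B`_i \in X].
Proof.
have [Y [YX fY eqY]] := span_free_subset X.
have dX : \dim <<X>> = size Y by rewrite -eqY; exact/eqP.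
pose Z := vbasis (<<Y>>^C)%VS.
have bB : basis_of fullv (Y ++ Z).
  rewrite -(addv_complf <<Y>>); apply: cat_basis.
  - by apply/directv_addP/capv_compl.
  - by rewrite /basis_of eqxx.
  - exact: vbasisP.
exists (Y ++ Z); split=> //.
- by rewrite -dimvf -(size_basis (X := in_tuple (Y ++ Z)) bB).
- by rewrite -dimvf dimvS ?subvf.
- by move=> i; rewrite dX => ltiY; rewrite nth_cat ltiY YX ?mem_nth.
Qed.

Lemma inner_sumr n (I : finType) (c : I -> 'F_2) (v : I -> 'rV['F_2]_n) x :
  inner x (\sum_j c j *: v j) = \sum_j c j * inner x (v j).
Proof.
rewrite /inner; under [RHS]eq_bigr => j _ do rewrite mulr_sumr.
rewrite exchange_big; apply: eq_bigr => i _.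
by rewrite summxE mulr_sumr; apply: eq_bigr => j _; rewrite mxE mulrCA.
Qed.

(** Pairings with a basis determine, by linearity, pairings with the unit vectors, which are the
    coordinates. *)
Lemma inner_basis_inj n (B : seq 'rV['F_2]_n) (x x' : 'rV['F_2]_n) :
  basis_of fullv B -> (forall i, (i < size B)%N -> inner x B`_i = inner x' B`_i) ->
  x = x'.
Proof.
move=> bB eqB; apply/rowP => j.
have inner_delta z : inner z (delta_mx ord0 j) = z ord0 j.
  rewrite /inner (bigD1 j) //= mxE !eqxx mulr1 big1 ?addr0 // => i /negPf neq.
  by rewrite mxE neq andbF mulr0.
rewrite -inner_delta -[RHS]inner_delta.
rewrite (coord_basis (X := in_tuple B) bB (memvf (delta_mx _ _))) !inner_sumr.
by apply: eq_bigr => i _; rewrite eqB.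
Qed.

(** * Signs as booleans, and the transport of F_2^n to the cube *)

Lemma pm1_neg_subproof : (-1 : int) \in [:: 1 : int; -1]. Proof. by []. Qed.
Lemma pm1_pos_subproof : (1 : int) \in [:: 1 : int; -1]. Proof. by []. Qed.
(** [true] stands for -1, so a boolean is the exponent of its sign and [(+)] multiplies signs. *)
Definition pm1_of_bool (b : bool) : pm1 :=
  if b then SeqSub pm1_neg_subproof else SeqSub pm1_pos_subproof.

Lemma ssval_pm1_of_bool b : ssval (pm1_of_bool b) = (-1) ^+ b.
Proof. by case: b. Qed.

Definition bool_of_pm1 (v : pm1) : bool := ssval v == -1.

Lemma pm1_of_boolK : cancel pm1_of_bool bool_of_pm1.
Proof. by case. Qed.

Lemma bool_of_pm1K : cancel bool_of_pm1 pm1_of_bool.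
Proof.
by case=> v vP; apply: val_inj; have := vP; rewrite 2!inE => /orP[]/eqP eqv;
  rewrite /= /bool_of_pm1 /= eqv.
Qed.

Lemma ssvalE (v : pm1) : ssval v = (-1) ^+ bool_of_pm1 v.
Proof. by rewrite -ssval_pm1_of_bool bool_of_pm1K. Qed.

Lemma sum_pm1 (V : nmodType) (F : pm1 -> V) :
  \sum_v F v = F (pm1_of_bool false) + F (pm1_of_bool true).
Proof.
rewrite (reindex pm1_of_bool) /=; last first.
  by exists bool_of_pm1 => v _; [exact: pm1_of_boolK | exact: bool_of_pm1K].
by rewrite big_bool addrC.
Qed.

Lemma card_cube n : #|cube n| = (2 ^ n)%N.
Proof. by rewrite card_ffun card_ord card_seq_sub. Qed.

Lemma card_rV2 n : #|{: 'rV['F_2]_n}| = (2 ^ n)%N.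
Proof. by rewrite card_mx card_Fp // mul1n. Qed.

Lemma sign_F2 (R : pzRingType) (u : 'F_2) :
  (-1) ^+ nat_of_ord u = (-1) ^+ (u != 0) :> R.
Proof. by case: u => [[|[|]]]. Qed.

Lemma F2_neq0_inj : injective (fun u : 'F_2 => u != 0).
Proof. by case=> [[|[|//]] ?] [[|[|//]] ?] // _; apply/val_inj. Qed.

Definition sign_map (n : nat) (B : seq 'rV['F_2]_n) (s : 'I_n -> bool)
    (x : 'rV['F_2]_n) : cube n :=
  [ffun i : 'I_n => pm1_of_bool (s i (+) (inner x B`_i != 0))].

Lemma coord_sign_map n (B : seq 'rV['F_2]_n) s x i :
  Defs.coord (sign_map B s x) i = (-1) ^+ (s i (+) (inner x B`_i != 0)).
Proof. by rewrite -ssval_pm1_of_bool; congr ssval; apply: ffunE. Qed.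

Lemma sign_map_bij n (B : seq 'rV['F_2]_n) s :
  basis_of fullv B -> size B = n -> bijective (sign_map B s).
Proof.
move=> bB sB; apply: inj_card_bij; last by rewrite card_cube card_rV2.
move=> x x' eqx; apply: (inner_basis_inj bB) => i; rewrite sB => lti.
move/ffunP/(_ (Ordinal lti)): eqx; rewrite !ffunE /= => /(can_inj pm1_of_boolK).
by move/addbI; apply: F2_neq0_inj.
Qed.

(** Expanding [psum] turns the right-hand sum into [2 ^+ n] times the sum of k absolute Fourier
    coefficients, each above [eps * norm1 f] because its basis vector lies in the spectrum. *)
Lemma Spec_embedding (R : realType) n (eps : R) (f : 'rV['F_2]_n -> R) :
  let k := dim_span_Spec eps f in
  (k <= n)%N /\
  exists2 phi : 'rV['F_2]_n -> cube n, bijective phi &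
    k%:R * (eps * norm1 f) * 2 ^+ n <= \sum_x f x * (psum k (phi x))%:~R.
Proof.
move=> k; have [B [bB sB kn BS]] := span_basis_prefix (enum (Spec eps f)).
have dn : dim 'rV['F_2]_n = n by exact: mul1n.
rewrite dn in sB kn.
(* The sign of each Fourier coefficient is chosen, so that every coordinate contributes an absolute
   value. *)
split=> //; pose s (i : 'I_n) := fourier f B`_i < 0.
exists (sign_map B s); first exact: sign_map_bij.
have -> : \sum_x f x * (psum k (sign_map B s x))%:~R =
    \sum_(i < n | (i < k)%N) 2 ^+ n * `|fourier f B`_i|.
  under eq_bigr => x _ do rewrite /psum (raddf_sum (intr : int -> R)) mulr_sumr.
  rewrite exchange_big; apply: eq_bigr => i _ /=.
  rewrite normrEsign mulrCA /fourier mulVKf ?expf_neq0 ?pnatr_eq0 //.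
  rewrite mulr_sumr; apply: eq_bigr => x _.
  rewrite coord_sign_map rmorph_sign signr_addb.
  by rewrite sign_F2 mulrCA.
rewrite -mulr_sumr mulrC ler_pM2l ?exprn_gt0 //.
rewrite -(big_ord_widen _ (fun i => `|fourier f B`_i|) kn).
rewrite mulr_natl -[k in _ *+ k]card_ord -sumr_const.
apply: ler_sum => i _; rewrite ltW //.
have := BS i (ltn_ord i); by rewrite mem_enum inE.
Qed.

(** * Counting points of the cube by their number of -1 entries *)

Definition neg_count n k (x : cube n) : nat :=
  (\sum_(i < n | (i < k)%N) bool_of_pm1 (x i))%N.

Lemma card_ord_lt n k : (k <= n)%N -> (\sum_(i < n | (i < k)%N) 1)%N = k.
Proof.
by move=> kn; rewrite -(big_ord_widen _ (fun=> 1%N) kn) sum1_card card_ord.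
Qed.

Lemma neg_count_le n k (x : cube n) : (k <= n)%N -> (neg_count k x <= k)%N.
Proof.
move=> kn; rewrite -[leqRHS](card_ord_lt kn); apply: leq_sum => i _.
exact: leq_b1.
Qed.

Lemma psumE n k (x : cube n) : (k <= n)%N ->
  psum k x = k%:Z - 2 * (neg_count k x)%:Z.
Proof.
move=> kn; rewrite -[in k%:Z](card_ord_lt kn) /psum /neg_count.
rewrite !(big_morph Posz PoszD (erefl _)) mulr_sumr -sumrB.
by apply: eq_bigr => i _; rewrite /Defs.coord ssvalE; case: bool_of_pm1.
Qed.

(** By generating functions: the sum of ['X^(neg_count k x)] factors over the coordinates, with
    factor [1 + 'X] for each of the first k and 2 for each other one. *)
Lemma sum_cube_neg_count (R : comNzRingType) n k (u : nat -> R) : (k <= n)%N ->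
  \sum_(x : cube n) u (neg_count k x) =
    2 ^+ (n - k) * \sum_(j < k.+1) u j *+ 'C(k, j).
Proof.
move=> kn.
have genfun : \sum_(x : cube n) 'X^(neg_count k x) =
    (2 ^+ (n - k) *: (1 + 'X) ^+ k : {poly R}).
  transitivity (\prod_(i < n) if (i < k)%N then 1 + 'X else 2 : {poly R}).
    transitivity (\prod_(i < n) \sum_(v : pm1)
        ('X^(if (i < k)%N then bool_of_pm1 v : nat else 0%N) : {poly R})).
      rewrite bigA_distr_bigA; apply: eq_bigr => x _.
      by rewrite /neg_count big_mkcond expr_sum.
    apply: eq_bigr => i _; rewrite sum_pm1 !pm1_of_boolK.
    by case: ifP => _; rewrite ?expr0 ?expr1.
  rewrite (bigID (fun i : 'I_n => (i < k)%N)) /=.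
  rewrite (eq_bigr (fun=> 1 + 'X)) => [|i ->//].
  rewrite [X in _ * X](eq_bigr (fun=> 2)) => [|i /negPf->//].
  rewrite !prodr_const mulrC -mul_polyC polyC_exp /= polyCMn.
  have cardk : #|(fun i : 'I_n => (i < k)%N)| = k.
    by rewrite -sum1_card -[RHS](card_ord_lt kn).
  congr (_ ^+ _ * _ ^+ _); last exact: cardk.
  rewrite -[in RHS](card_ord n) -[in RHS]cardk.
  by rewrite -(cardC (fun i : 'I_n => (i < k)%N)) addKn.
(* This linear functional sends ['X^j] to [u j] for [j <= k]; the truncation loses nothing since
   [neg_count k x <= k]. *)
pose L (p : {poly R}) := \sum_(j < k.+1) p`_j * u j.
transitivity (L (\sum_(x : cube n) 'X^(neg_count k x))).
  rewrite /L; under [RHS]eq_bigr => j _ do rewrite coef_sum mulr_suml.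
  rewrite exchange_big; apply: eq_bigr => x _ /=.
  rewrite (bigD1 (inord (neg_count k x))) //= inordK ?ltnS ?neg_count_le //.
  rewrite coefXn eqxx mul1r big1 ?addr0 // => j; rewrite coefXn -val_eqE /=.
  by rewrite inordK ?ltnS ?neg_count_le // => /negPf->; rewrite mul0r.
rewrite genfun /L mulr_sumr; apply: eq_bigr => j _.
rewrite coefZ -mulrA; congr (_ * _).
rewrite exprDn coef_sum (bigD1 j) //= expr1n mul1r coefMn coefXn eqxx.
rewrite big1 ?addr0 ?mulr_natl // => i neq; rewrite expr1n mul1r coefMn coefXn.
by rewrite eq_sym val_eqE (negPf neq) mul0rn.
Qed.

(** The sum telescopes: Pascal's rule and [(r+1) C(k,r+1) = k C(k-1,r)] give [k C(k-1,r) + (k -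
    2(r+1)) C(k,r+1) = k C(k-1,r+1)]. *)
Lemma sum_psum_ball (k r : nat) : (0 < k)%N ->
  \sum_(j < r.+1) (k%:Z - 2 * j%:Z) *+ 'C(k, j) = (k * 'C(k.-1, r))%:Z.
Proof.
case: k => // k _; elim: r => [|r IH].
  by rewrite big_ord1 !bin0 mulr0 subr0 muln1.
rewrite big_ord_recr /= IH.
have := mul_bin_diag k.+1 r; rewrite /= binS => eqdiag.
rewrite -mulr_natr natz; nia.
Qed.

(** * Symmetry and level-1 coefficients *)

Lemma expectation_reindex (R : realType) n (p : {perm 'I_n}) (g : cube n -> R) :
  expectation g = expectation (fun x : cube n => g [ffun i => x (p i)]).
Proof.
rewrite /expectation; congr (_ / _).
apply: (reindex (fun x : cube n => [ffun i => x (p i)] : cube n)).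
exists (fun x : cube n => [ffun i => x ((p^-1)%g i)] : cube n) => x _;
  by apply/ffunP => i; rewrite !ffunE ?permK ?permKV.
Qed.

Lemma psum_tperm n k (i j : 'I_n) (x : cube n) : (i < k)%N -> (j < k)%N ->
  psum k ([ffun l => x (tperm i j l)] : cube n) = psum k x.
Proof.
move=> ik jk; rewrite /psum [RHS](reindex_inj (@perm_inj _ (tperm i j))) /=.
apply: eq_big => [l|l _]; first by case: tpermP => // ->; rewrite ik jk.
by rewrite /Defs.coord; congr ssval; apply: ffunE.
Qed.

(** Swapping two of the first k coordinates preserves the uniform measure and [psum], and exchanges
    the two coefficients. *)
Lemma coefs_equal_psum (R : realType) n k (u : int -> R) (g : cube n -> R) :
  (forall x, g x = u (psum k x)) -> coefs_equal k g.
Proof.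
move=> gE i j ik jk; rewrite /level1_coef (expectation_reindex (tperm i j)).
rewrite /expectation; congr (_ / _); apply: eq_bigr => x _.
rewrite !gE psum_tperm // /Defs.coord; congr (_ * (ssval _)%:~R).
by rewrite ffunE tpermL.
Qed.

Lemma sum_level1_coef (R : realType) n k (g : cube n -> R) :
  \sum_(i < n | (i < k)%N) level1_coef g i =
    expectation (fun x : cube n => g x * (psum k x)%:~R).
Proof.
rewrite /level1_coef /expectation -mulr_suml exchange_big; congr (_ / _).
by apply: eq_bigr => x _; rewrite -mulr_sumr /psum (raddf_sum (intr : int -> R)).
Qed.

Lemma level1_coef_psum (R : realType) n k (g : cube n -> R) (i : 'I_n) :
  (k <= n)%N -> (i < k)%N -> coefs_equal k g ->
  k%:R * level1_coef g i = expectation (fun x : cube n => g x * (psum k x)%:~R).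
Proof.
move=> kn ik eqg; rewrite -sum_level1_coef (eq_bigr (fun=> level1_coef g i)).
  rewrite -[in LHS](card_ord_lt kn) natr_sum mulr_suml.
  by apply: eq_bigr => j _; rewrite mul1r.
by move=> j jk; apply: eqg.
Qed.

(** * The spectral lower bound for threshold functions *)

Lemma norm1_bool (R : realType) n (f : 'rV['F_2]_n -> R) :
  (forall x, f x = 0 \/ f x = 1) -> norm1 f = expectation f.
Proof.
move=> hf; congr (_ / _); apply: eq_bigr => x _.
by case: (hf x) => ->; rewrite ?normr0 ?normr1.
Qed.

(** A function with values 0, 1 and mean 0 vanishes, as do its Fourier coefficients; the strict
    inequality defining [Spec] then leaves the spectrum empty. This justifies the later divisions by
    a. *)
Lemma expectation_gt0_Spec (R : realType) n (eps : R) (f : 'rV['F_2]_n -> R) :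
  (forall x, f x = 0 \/ f x = 1) -> (0 < dim_span_Spec eps f)%N ->
  0 < expectation f.
Proof.
move=> hf; apply: contraTT => a_le0.
have f_ge0 x : 0 <= f x by case: (hf x) => ->.
have N_gt0 : 0 < #|{: 'rV['F_2]_n}|%:R :> R by rewrite card_rV2 ltr0n expn_gt0.
have sum0 : \sum_x f x = 0.
  apply/eqP; rewrite eq_le sumr_ge0 // andbT leNgt.
  by apply: contra a_le0 => sum_gt0; rewrite /expectation divr_gt0.
have f0 x : f x = 0 by have /psumr_eq0P -> := sum0.
rewrite /dim_span_Spec; suff -> : Spec eps f = set0.
  by rewrite enum_set0 span_nil dimv0.
apply/setP => y; rewrite !inE norm1_bool // /expectation sum0 mul0r mulr0.
by rewrite /fourier big1 ?mulr0 ?normr0 ?ltxx // => x _; rewrite f0 mul0r.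
Qed.

(** Carried to the cube, [f] competes with [G] at equal mean, so [sum_threshold_le] applies. A real
    [t] accommodates both a natural b and the possibly negative radius bound [k - 2r]. *)
Lemma Spec_threshold_bound (R : realType) n (eps : R) (f : 'rV['F_2]_n -> R)
    (G : cube n -> R) (t : R) :
  (forall x, f x = 0 \/ f x = 1) ->
  let k := dim_span_Spec eps f in
  (forall x, t < (psum k x)%:~R -> G x = 1) ->
  (forall x, (psum k x)%:~R < t -> G x = 0) ->
  expectation G = expectation f ->
  k%:R * (eps * expectation f) <= expectation (fun x => G x * (psum k x)%:~R).
Proof.
move=> hf k G1 G0 eqE; have [kn [phi phi_bij]] := Spec_embedding eps f.
rewrite norm1_bool // -/k => le_f; case: (phi_bij) => psi phiK psiK.
have N_gt0 : 0 < 2 ^+ n :> R by rewrite exprn_gt0.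
rewrite [X in _ <= X]/expectation card_cube natrX ler_pdivlMr //.
apply: le_trans le_f _.
rewrite (reindex psi); last exact: onW_bij (Bijective psiK phiK).
under eq_bigr => x _ do rewrite psiK.
apply: (sum_threshold_le (t := t)) => // [x|].
  by case: (hf (psi x)) => ->; rewrite lexx ler01.
have := eqE; rewrite /expectation card_cube card_rV2 => /mulIf ->.
  by rewrite [RHS](reindex psi) //; exact: onW_bij (Bijective psiK phiK).
by rewrite invr_eq0 natrX gt_eqF.
Qed.

(** * Measure and first moment of Hamming balls *)

Lemma mem_hamming_ball n k r (x : cube n) : (k <= n)%N ->
  (x \in hamming_ball n k r) = (neg_count k x <= r)%N.
Proof. by move=> kn; rewrite inE psumE //; lia. Qed.

Lemma sum_hamming_ball (R : comNzRingType) n k r (v : nat -> R) :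
  (k <= n)%N -> (r <= k)%N ->
  \sum_(x in hamming_ball n k r) v (neg_count k x) =
    2 ^+ (n - k) * \sum_(j < r.+1) v j *+ 'C(k, j).
Proof.
move=> kn rk; rewrite big_mkcond /=.
under eq_bigr => x _ do rewrite mem_hamming_ball //.
(* The weight is extended by 0 beyond r; [r <= k] keeps the ball's range inside that of the full
   sum. *)
rewrite (sum_cube_neg_count (fun j => if (j <= r)%N then v j else 0)) //.
congr (_ * _); rewrite (big_ord_widen k.+1 (fun j => v j *+ 'C(k, j))) //.
rewrite [RHS]big_mkcond; apply: eq_bigr => j _.
by rewrite ltnS; case: leqP; rewrite ?mul0rn.
Qed.

Lemma mu_indic (R : realType) n (C : {set cube n}) :
  mu R C = expectation (indic R C).
Proof.
by rewrite /mu /expectation -sum1_card natr_sum big_mkcond; congr (_ / _);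
  apply: eq_bigr => x _; rewrite /indic; case: (x \in C).
Qed.

Lemma mu_proper (R : realType) n (A B : {set cube n}) :
  A \proper B -> mu R A < mu R B.
Proof.
by move=> /proper_card AB; rewrite ltr_pM2r ?ltr_nat // invr_gt0 ltr0n card_cube
  expn_gt0.
Qed.

Lemma expectation_le (R : realType) (T : finType) (g h : T -> R) :
  (forall x, g x <= h x) -> expectation g <= expectation h.
Proof. by move=> gh; rewrite ler_wpM2r ?invr_ge0 ?ler0n // ler_sum. Qed.

Lemma indic_mul (R : realType) n (C : {set cube n}) (v : cube n -> R) :
  \sum_x indic R C x * v x = \sum_(x in C) v x.
Proof.
rewrite [RHS]big_mkcond; apply: eq_bigr => x _.
by rewrite /indic; case: (x \in C); rewrite ?mul1r ?mul0r.
Qed.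

Lemma expectation_hamming_ball (R : realType) n k r (v : nat -> R) :
  (k <= n)%N -> (r <= k)%N ->
  expectation (fun x : cube n =>
      indic R (hamming_ball n k r) x * v (neg_count k x)) =
    2 ^- k * \sum_(j < r.+1) v j *+ 'C(k, j).
Proof.
move=> kn rk; rewrite /expectation indic_mul sum_hamming_ball // card_cube natrX.
rewrite mulrAC; congr (_ * _).
rewrite -[X in _ / 2 ^+ X](subnK kn) exprD invfM mulrA divff ?mul1r //.
by rewrite expf_neq0 ?pnatr_eq0.
Qed.

Lemma mu_hamming_ball (R : realType) n k r : (k <= n)%N -> (r <= k)%N ->
  mu R (hamming_ball n k r) = 2 ^- k * (bin_le k r)%:R.
Proof.
move=> kn rk; have := @expectation_hamming_ball R n k r (fun=> 1) kn rk.
rewrite mu_indic /bin_le big_mkord natr_sum => <-.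
by congr (_ / _); apply: eq_bigr => x _; rewrite mulr1.
Qed.

Lemma psum_hamming_ball (R : realType) n k r :
  (0 < k)%N -> (k <= n)%N -> (r <= k)%N ->
  expectation (fun x : cube n =>
      indic R (hamming_ball n k r) x * (psum k x)%:~R) =
    2 ^- k * (k * 'C(k.-1, r))%:R.
Proof.
move=> k0 kn rk.
have := expectation_hamming_ball (fun j => (k%:Z - 2 * j%:Z)%:~R : R) kn rk.
under [X in _ = _ * X]eq_bigr => j _ do rewrite -rmorphMn.
rewrite -(raddf_sum (intr : int -> R)) sum_psum_ball // => <-.
by congr (_ / _); apply: eq_bigr => x _; rewrite psumE.
Qed.

(** * Threshold functions and the sets between their level sets *)

Lemma threshold_ge_indic (R : realType) n k b (lambda : R) (x : cube n) :
  0 <= lambda ->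
  indic R [set x | b%:Z < psum k x] x <= threshold k b lambda x.
Proof.
by move=> l0; rewrite /indic inE lerDl mulr_ge0 ?ler0n.
Qed.

Lemma threshold_le_indic (R : realType) n k b (lambda : R) (x : cube n) :
  lambda <= 1 ->
  threshold k b lambda x <= indic R [set x | b%:Z <= psum k x] x.
Proof.
move=> l1; rewrite /indic inE /threshold.
by case: (ltgtP b%:Z (psum k x)) => // _; rewrite ?mulr0 ?addr0 ?mulr1 ?add0r.
Qed.

Lemma threshold_itv (R : realType) n k b (lambda : R) (x : cube n) :
  0 < lambda -> lambda <= 1 -> 0 <= threshold k b lambda x <= 1.
Proof.
move=> l0 l1; rewrite /threshold.
by case: (ltgtP b%:Z (psum k x)) => // _;
  rewrite ?mulr0 ?addr0 ?mulr1 ?add0r ?lexx ?ler01 // l1 ltW.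
Qed.

Lemma threshold_eq1 (R : realType) n k b (lambda : R) (x : cube n) :
  b%:R < (psum k x)%:~R :> R -> threshold k b lambda x = 1.
Proof.
rewrite (ltr_int R b%:Z) /threshold => bx.
by rewrite bx gt_eqF // mulr0 addr0.
Qed.

Lemma threshold_eq0 (R : realType) n k b (lambda : R) (x : cube n) :
  (psum k x)%:~R < b%:R :> R -> threshold k b lambda x = 0.
Proof.
rewrite (ltr_int R _ b%:Z) /threshold => bx.
by rewrite lt_gtF // lt_eqF // mulr0 addr0.
Qed.

Lemma sandwiched_eq1 (R : realType) n k b (C : {set cube n}) x :
  sandwiched k b C -> b%:R < (psum k x)%:~R :> R -> indic R C x = 1.
Proof.
move=> /andP[/subsetP lbC _]; rewrite (ltr_int R b%:Z) => bx.
by rewrite /indic lbC // inE.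
Qed.

Lemma sandwiched_eq0 (R : realType) n k b (C : {set cube n}) x :
  sandwiched k b C -> (psum k x)%:~R < b%:R :> R -> indic R C x = 0.
Proof.
move=> /andP[_ /subsetP Cub]; rewrite (ltr_int R _ b%:Z) => bx.
rewrite /indic; have := Cub x; rewrite inE leNgt bx.
by case: (x \in C) => // /(_ isT).
Qed.

Lemma indic_itv (R : realType) n (C : {set cube n}) x : 0 <= indic R C x <= 1.
Proof. by rewrite /indic ler0n lern1 leq_b1. Qed.

Lemma sandwiched_psum (R : realType) n k b (lambda : R) (C : {set cube n}) :
  0 < lambda -> lambda <= 1 -> sandwiched k b C ->
  expectation (threshold k b lambda : cube n -> R) = mu R C ->
  expectation (fun x : cube n => indic R C x * (psum k x)%:~R) =
    expectation (fun x : cube n => threshold k b lambda x * (psum k x)%:~R).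
Proof.
move=> l0 l1 sC; rewrite mu_indic => /mulIf eqE; congr (_ / _).
have {}eqE : \sum_(x : cube n) threshold k b lambda x = \sum_x indic R C x.
  by apply: eqE; rewrite invr_eq0 card_cube pnatr_eq0 expn_eq0.
(* Both functions are thresholds at b with the same total, so each is extremal against the other. *)
apply: le_anti; rewrite !(sum_threshold_le (t := b%:R)) // => x.
- exact: threshold_itv.
- exact: sandwiched_eq1.
- exact: sandwiched_eq0.
- exact: indic_itv.
- exact: threshold_eq1.
- exact: threshold_eq0.
Qed.

(** The ball and both level sets are upper sets of [psum], hence nested, so measure decides
    inclusion; the mean of the threshold function lies between the measures of the level sets. *)
Lemma hamming_ball_sandwiched (R : realType) n k r b (lambda : R) :
  0 < lambda -> lambda <= 1 ->
  expectation (threshold k b lambda : cube n -> R) = mu R (hamming_ball n k r) ->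
  sandwiched k b (hamming_ball n k r).
Proof.
move=> l0 l1 eqE; set B := hamming_ball n k r in eqE *.
have le_mu : mu R [set x : cube n | b%:Z < psum k x] <= mu R B.
  rewrite -eqE mu_indic; apply: expectation_le => x.
  by rewrite threshold_ge_indic ?ltW.
have ge_mu : mu R B <= mu R [set x : cube n | b%:Z <= psum k x].
  rewrite -eqE [leRHS]mu_indic; apply: expectation_le => x.
  by rewrite threshold_le_indic.
apply/andP; split; apply/subsetP => x; rewrite !inE => xin; apply: contraT.
(* A point above b but outside the ball would make the ball a proper subset of the upper level set,
   against [le_mu]. *)
- rewrite -ltNge => xlt; move: le_mu; rewrite leNgt mu_proper //.
  apply/properP; split; last by exists x; rewrite !inE // -ltNge.
  by apply/subsetP => y; rewrite !inE => /(lt_le_trans xlt)/(lt_trans xin).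
- rewrite -ltNge => xlt; move: ge_mu; rewrite leNgt mu_proper //.
  apply/properP; split; last by exists x; rewrite !inE // -ltNge.
  by apply/subsetP => y; rewrite !inE => /(lt_le_trans xlt)/ltW/(le_trans xin).
Qed.

Theorem corollary2 (R : realType) (n : nat) (eps : R) (heps : 0 < eps)
    (f : 'rV['F_2]_n -> R) (hf : forall x, f x = 0 \/ f x = 1)
    (a : R) (ha : a = expectation f)
    (k : nat) (hk : k = dim_span_Spec eps f) (hk1 : (1 <= k)%N) :
  (forall (b : nat) (lambda : R),
     0 < lambda -> lambda <= 1 ->
     expectation (threshold k b lambda : cube n -> R) = a ->
     forall C : {set cube n},
       mu R C = a -> sandwiched k b C -> coefs_equal k (indic R C) ->
       exists2 i1 : 'I_n, nat_of_ord i1 = 0%N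
         & level1_coef (indic R C) i1 = level1_coef (threshold k b lambda) i1
           /\ eps <= a^-1 * level1_coef (indic R C) i1)
  /\
  (forall r : nat, (r <= k)%N ->
     a = 2 ^- k * (bin_le k r)%:R ->
     [/\ mu R (hamming_ball n k r) = a,
         coefs_equal k (indic R (hamming_ball n k r)),
         (forall (b : nat) (lambda : R),
            0 < lambda -> lambda <= 1 ->
            expectation (threshold k b lambda : cube n -> R) = a ->
            sandwiched k b (hamming_ball n k r))
       & eps <= ('C(k.-1, r))%:R / (bin_le k r)%:R]).
Proof.
have a_gt0 : 0 < a by rewrite ha (expectation_gt0_Spec (eps := eps)) // -hk.
have [kn _] := Spec_embedding eps f; rewrite -hk in kn.
have k_gt0 : 0 < k%:R :> R by rewrite ltr0n.
have bound (G : cube n -> R) (t : R)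
    (G1 : forall x, t < (psum k x)%:~R -> G x = 1)
    (G0 : forall x, (psum k x)%:~R < t -> G x = 0) (EG : expectation G = a) :
    k%:R * (eps * a) <= expectation (fun x => G x * (psum k x)%:~R).
  rewrite ha; move: G1 G0; rewrite hk => G1 G0.
  by apply: (Spec_threshold_bound hf G1 G0); rewrite EG.
split=> [b lambda l0 l1 Eh C muC sC eqC | r rk eqa].
- have n0 : (0 < n)%N := leq_trans hk1 kn.
  exists (Ordinal n0) => //.
  have kC := level1_coef_psum (i := Ordinal n0) kn hk1 eqC.
  have eqh : coefs_equal k (threshold k b lambda : cube n -> R).
    exact: (coefs_equal_psum
      (u := fun z => (b%:Z < z)%R%:R + lambda * (z == b%:Z)%:R)).
  have kh := level1_coef_psum (i := Ordinal n0) kn hk1 eqh.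
  split.
    (* After multiplication by k, both coefficients become first moments of [psum]. *)
    apply: (mulfI (lt0r_neq0 k_gt0)); rewrite kC kh.
    by apply: (sandwiched_psum l0 l1) => //; rewrite Eh muC.
  rewrite mulrC ler_pdivlMr // -(ler_pM2l k_gt0) kC.
  apply: (bound _ b%:R); [| |by rewrite -mu_indic].
    by move=> x; apply: sandwiched_eq1.
  by move=> x; apply: sandwiched_eq0.
- have muB : mu R (hamming_ball n k r) = a by rewrite eqa mu_hamming_ball.
  split=> //.
  + apply: (coefs_equal_psum (u := fun z => (k%:Z - 2 * r%:Z <= z)%R%:R)) => x.
    by rewrite /indic inE.
  + move=> b lambda l0 l1 Eh.
    by refine (hamming_ball_sandwiched l0 l1 _); rewrite Eh.
  + have pow_gt0 : 0 < 2 ^- k :> R by rewrite invr_gt0 exprn_gt0.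
    (* Positivity is inherited from a, which is a positive multiple of this binomial sum. *)
    have bin_gt0 : 0 < (bin_le k r)%:R :> R.
      by rewrite -(pmulr_rgt0 _ pow_gt0) -eqa.
    (* Scaling by [k * 2 ^- k] turns the numerator into the first moment of the ball and the
       denominator into [k * a]. *)
    rewrite ler_pdivlMr // -(ler_pM2l k_gt0) -(ler_pM2l pow_gt0) -natrM.
    rewrite -(psum_hamming_ball R hk1 kn rk) mulrCA (mulrCA _ eps) -eqa.
    apply: (bound _ (k%:Z - 2 * r%:Z)%:~R); [| |by rewrite -mu_indic].
      by move=> x; rewrite ltr_int /indic inE => /ltW ->.
    by move=> x; rewrite ltr_int /indic inE leNgt => ->.
Qed.
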